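(* Let $\mathrm{TM}$ be the model over $\{0,1\}^*$ consisting of all total functions $\{0,1\}^*\to\{0,1\}^*$ computed by Turing machines. Then $\mathrm{TM}$ is complete: for every model $M$ over $\{0,1\}^*$ with $M\supseteq\mathrm{TM}$ and $\mathrm{TM}\succsim M$, we have $M=\mathrm{TM}$.
   Context: A model of computation over a set $D$ is any set of functions $f:D\to D\cup\{\bot\}$, where $\bot$ denotes ''undefined''. An encoding is an injection $\rho:\mathrm{dom}\,B\to\mathrm{dom}\,A$, extended by $\rho(\bot)=\bot$. Model $A$ simulates model $B$ via $\rho$, written $A\succsim_\rho B$, if for every $g\in B$ there is $f\in A$ with $\rho\circ g=f\circ\rho$. $A\succsim B$ means $A\succsim_\rho B$ for some injection $\rho$. *)

(* Defs.v *)
From HB Require Import structures.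
From mathcomp Require Import all_boot.
From mathcomp Require Import boolp classical_sets.

Set Implicit Arguments.
Unset Strict Implicit.
Unset Printing Implicit Defensive.

Local Open Scope classical_set_scope.

(* [None] plays the role of the undefined value. *)
Definition model (D : Type) := set (D -> option D).

(* [omap rho] is the extension of [rho] sending undefined to undefined. *)
Definition simulates_via (DA DB : Type) (rho : DB -> DA)
    (A : model DA) (B : model DB) : Prop :=
  forall g, B g -> exists2 f, A f & omap rho \o g = f \o rho.

Definition simulates (DA DB : Type) (A : model DA) (B : model DB) : Prop :=
  exists2 rho : DB -> DA, injective rho & simulates_via rho A B.

Definition bitstring := seq bool.

Inductive direction := MoveLeft | MoveRight | Stay.

(* The tape alphabet is the disjoint union of the blank [None], the input
   alphabet {0,1} and an arbitrary finite set of auxiliary symbols. *)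
Definition symbol (aux : finType) : Type := option (bool + aux).

(* Deterministic one-tape machine; it halts when [tm_trans] returns [None]. *)
Record turing_machine := TuringMachine {
  tm_state : finType;
  tm_aux : finType;
  tm_start : tm_state;
  tm_trans : tm_state -> symbol tm_aux ->
             option (tm_state * symbol tm_aux * direction)
}.

(* The tape is infinite to the right only, with cells indexed by [nat]. *)
Record config (T : turing_machine) := Config {
  cfg_state : tm_state T;
  cfg_head : nat;
  cfg_tape : nat -> symbol (tm_aux T)
}.

(* Moving left from the leftmost cell leaves the head in place. *)
Definition move_head (d : direction) (h : nat) : nat :=
  match d with
  | MoveLeft => h.-1
  | MoveRight => h.+1
  | Stay => h
  end.

Definition tm_step (T : turing_machine) (c : config T) : option (config T) :=
  match tm_trans (cfg_state c) (cfg_tape c (cfg_head c)) with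
  | None => None
  | Some (q, s, d) =>
      Some (Config q (move_head d (cfg_head c))
             (fun i => if i == cfg_head c then s else cfg_tape c i))
  end.

Inductive tm_reaches (T : turing_machine) (c : config T) : config T -> Prop :=
| tm_reaches_refl : tm_reaches c c
| tm_reaches_step c1 c2 :
    tm_reaches c c1 -> tm_step c1 = Some c2 -> tm_reaches c c2.

Definition tape_of (aux : finType) (w : bitstring) (i : nat) : symbol aux :=
  nth None [seq Some (inl b) | b <- w] i.

Definition tm_init (T : turing_machine) (w : bitstring) : config T :=
  Config (tm_start T) 0 (@tape_of (tm_aux T) w).

(* On halting, the tape must hold the output and nothing else; the final
   position of the head is irrelevant. *)
Definition tm_outputs (T : turing_machine) (w v : bitstring) : Prop :=
  exists c : config T,
    [/\ tm_reaches (tm_init T w) c, tm_step c = None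
      & cfg_tape c =1 @tape_of (tm_aux T) v].

Definition tm_computes (T : turing_machine) (h : bitstring -> bitstring) :
    Prop :=
  forall w, tm_outputs T w (h w).

Definition TM : model bitstring :=
  [set f | exists2 h : bitstring -> bitstring,
             (exists T, tm_computes T h) & f = Some \o h].

(* Main.v *)
Require Import Defs.
From mathcomp Require Import all_boot.
From mathcomp Require Import boolp classical_sets.

(** Let [rho] witness that TM simulates M, and let [s] be the successor of an
    enumeration of all bitstrings starting from the empty one.  As [s] is
    computable, some computable [hs] satisfies [rho \o s = hs \o rho]; iterating
    [s] and [hs] in parallel from [[::]] and [rho [::]] lists the graph of
    [rho].  Scanning this list computes both [rho] and its inverse on its range.
    Any [g] in M satisfies [rho \o g = f \o rho] with [f] computable and total,
    so [g] is total and [g = rho^-1 \o f \o rho] is computable.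

    The machine for [g] keeps several words on parallel tracks of one tape.  A
    subroutine acts on a single track and brings the head back to cell 0, which
    carries a flag, so there is only ever one head to keep track of. *)

Set Implicit Arguments.
Unset Strict Implicit.
Unset Printing Implicit Defensive.

Local Open Scope classical_set_scope.

(** * Procedures *)

(* A machine fragment over an arbitrary alphabet, which exits with a boolean. *)
Record procedure (A : Type) := Procedure {
  proc_state : finType;
  proc_start : proc_state;
  proc_trans : proc_state -> A -> (proc_state * A * direction) + bool
}.

Definition tape_write (A : Type) (t : nat -> A) (h : nat) (a : A) : nat -> A :=
  fun i => if i == h then a else t i.

Lemma tape_write_same (A : Type) (t : nat -> A) h : tape_write t h (t h) = t.
Proof. by apply/funext => i; rewrite /tape_write; case: eqP => // ->. Qed.

(** Big-step semantics: a derivation is itself a terminating run, so termination is part of every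
    execution statement. *)
Inductive runs (A : Type) (p : procedure A) :
    proc_state p -> nat -> (nat -> A) -> bool -> nat -> (nat -> A) -> Prop :=
| runs_exit q h t b :
    proc_trans q (t h) = inr b -> runs q h t b h t
| runs_step q h t q' a d b h' t' :
    proc_trans q (t h) = inl (q', a, d) ->
    runs q' (move_head d h) (tape_write t h a) b h' t' ->
    runs q h t b h' t'.

Definition executes (A : Type) (p : procedure A) := runs (proc_start p).

Lemma runs_stay (A : Type) (p : procedure A) (q q' : proc_state p) d h t b h' t' :
  proc_trans q (t h) = inl (q', t h, d) ->
  runs q' (move_head d h) t b h' t' -> runs q h t b h' t'.
Proof. by move=> e r; apply: runs_step e _; rewrite tape_write_same. Qed.

(** Short-circuiting on [false] lets a test placed first guard the body of a [loop]. *)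
Definition and_then (A : Type) (p p' : procedure A) : procedure A :=
  @Procedure A (proc_state p + proc_state p')%type (inl (proc_start p))
    (fun q a => match q with
      | inl q1 => match proc_trans q1 a with
          | inl (q1', a', d) => inl (inl q1', a', d)
          | inr true => inl (inr (proc_start p'), a, Stay)
          | inr false => inr false
          end
      | inr q2 => match proc_trans q2 a with
          | inl (q2', a', d) => inl (inr q2', a', d)
          | inr b => inr b
          end
      end).

Lemma and_then_false (A : Type) (p p' : procedure A) h t h' t' :
  executes p h t false h' t' -> executes (and_then p p') h t false h' t'.
Proof.
rewrite /executes /=; move: (proc_start p) => q.
move eb: false => b r; elim: r eb => {q h t b h' t'}.
  by move=> q h t b e eb; apply: runs_exit; rewrite /= e -eb.
move=> q h t q' a d b h' t' e _ IH eb.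
by apply: runs_step (IH eb); rewrite /= e.
Qed.

Lemma and_then_true (A : Type) (p p' : procedure A) h t h1 t1 b h' t' :
  executes p h t true h1 t1 -> executes p' h1 t1 b h' t' ->
  executes (and_then p p') h t b h' t'.
Proof.
move=> r r2.
have {}r2 : @runs _ (and_then p p') (inr (proc_start p')) h1 t1 b h' t'.
  elim: r2 => {r b h' t' h1 t1} => [q h1 t1 b e|q h1 t1 q' a d b h' t' e _ IH].
    by apply: runs_exit; rewrite /= e.
  by apply: runs_step IH; rewrite /= e.
move: r; rewrite /executes /=; move: (proc_start p) => q.
move eb: true => b1 r; elim: r eb r2 => {q h t b1 h1 t1}.
  by move=> q h t b1 e eb r2; apply: (runs_stay (d := Stay)) r2; rewrite /= e -eb.
move=> q h t q' a d b1 h1 t1 e _ IH eb r2.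
by apply: runs_step (IH eb r2); rewrite /= e.
Qed.

(** The loop itself only ever exits with [true], so that [and_then] can continue after it. *)
Definition loop (A : Type) (p : procedure A) : procedure A :=
  @Procedure A (proc_state p) (proc_start p)
    (fun q a => match proc_trans q a with
      | inl x => inl x
      | inr true => inl (proc_start p, a, Stay)
      | inr false => inr true
      end).

Lemma loop_exit (A : Type) (p : procedure A) h t h' t' :
  executes p h t false h' t' -> executes (loop p) h t true h' t'.
Proof.
rewrite /executes /=; move: (proc_start p) => q.
move eb: false => b r; elim: r eb => {q h t b h' t'}.
  by move=> q h t b e eb; apply: runs_exit; rewrite /= e -eb.
move=> q h t q' a d b h' t' e _ IH eb.
by apply: runs_step (IH eb); rewrite /= e.
Qed.

Lemma loop_continue (A : Type) (p : procedure A) h t h1 t1 b h' t' :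
  executes p h t true h1 t1 -> executes (loop p) h1 t1 b h' t' ->
  executes (loop p) h t b h' t'.
Proof.
(* Only the state within the current pass is generalized; [r2] keeps the start state, where the next
   pass begins. *)
rewrite /executes /= => r r2; move: r; move: {1 2}(proc_start p) => q.
move eb: true => b1 r; elim: r eb r2 => {q h t b1 h1 t1}.
  by move=> q h t b1 e eb r2; apply: (runs_stay (d := Stay)) r2; rewrite /= e -eb.
move=> q h t q' a d b1 h1 t1 e _ IH eb r2.
by apply: runs_step (IH eb r2); rewrite /= e.
Qed.

(** * Compilation of procedures to Turing machines *)

Definition tm_of_procedure (A : Type) (aux : finType) (enc : A -> symbol aux)
    (dec : symbol aux -> A) (p : procedure A) : turing_machine :=
  @TuringMachine (proc_state p) aux (proc_start p)
    (fun q s => match proc_trans q (dec s) with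
      | inl (q', a, d) => Some (q', enc a, d)
      | inr _ => None
      end).

Lemma tm_reaches_trans (T : turing_machine) (c1 c2 c3 : config T) :
  tm_reaches c1 c2 -> tm_reaches c2 c3 -> tm_reaches c1 c3.
Proof. by move=> r; elim=> // c c' _ r' e; apply: tm_reaches_step r' e. Qed.

Lemma tm_of_procedure_runs (A : Type) (aux : finType) (enc : A -> symbol aux)
    (dec : symbol aux -> A) (p : procedure A) (q : proc_state p) h t b h' t' :
  cancel enc dec -> runs q h t b h' t' ->
  exists c : config (tm_of_procedure enc dec p),
    [/\ tm_reaches (@Config (tm_of_procedure enc dec p) q h (enc \o t)) c,
        tm_step c = None & cfg_tape c = enc \o t'].
Proof.
move=> encK; elim=> {q h t b h' t'} [q h t b e|q h t q' a d b h' t' e _ [c [r s u]]].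
  exists (@Config (tm_of_procedure enc dec p) q h (enc \o t)).
  by split=> //; [exact: tm_reaches_refl|rewrite /tm_step /= encK e].
exists c; split=> //; apply: tm_reaches_trans r.
apply: tm_reaches_step (tm_reaches_refl _) _.
rewrite /tm_step /= encK e; congr (Some (Config _ _ _)).
by apply/funext => i /=; rewrite /tape_write; case: eqP.
Qed.

(** * Tracks *)

Section Tracks.
Variables (k : nat) (X : finType).

(* The flag marks cell 0 of the tape. *)
Definition cell : Type := (bool * {ffun 'I_k -> symbol X})%type.

Definition tracks (S : 'I_k -> nat -> symbol X) : nat -> cell :=
  fun i => (i == 0, [ffun j => S j i]).

Definition put (I : eqType) (T : Type) (S : I -> T) (j : I) (x : T) : I -> T :=
  fun j' => if j' == j then x else S j'.

Lemma put_same (I : eqType) (T : Type) (S : I -> T) j x : put S j x j = x.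
Proof. by rewrite /put eqxx. Qed.

Lemma put_other (I : eqType) (T : Type) (S : I -> T) j j' x :
  j' != j -> put S j x j' = S j'.
Proof. by rewrite /put => /negbTE ->. Qed.

Definition word_tracks (W : 'I_k -> bitstring) : nat -> cell :=
  tracks (fun j => @tape_of X (W j)).

Definition home_trans (Q : Type) (q : Q) (b : bool) (c : cell) :
    (Q * cell * direction) + bool :=
  if c.1 then inr b else inl (q, c, MoveLeft).

(** The flag is set at cell 0 only, so the walk to the left stops exactly there. *)
Lemma home_runs (p : procedure cell) (q : proc_state p) b h S :
  (forall c, proc_trans q c = home_trans q b c) ->
  runs q h (tracks S) b 0 (tracks S).
Proof.
move=> e; elim: h => [|h IH].
  by apply: runs_exit; rewrite e.
by apply: (runs_stay (d := MoveLeft)); last exact: IH; rewrite e.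
Qed.

Section RunOnTrack.
Variables (T : turing_machine) (inj : tm_aux T -> X) (prj : X -> option (tm_aux T)).
Hypothesis injK : pcancel inj prj.

Definition sym_inj (s : symbol (tm_aux T)) : symbol X :=
  match s with
  | None => None
  | Some (inl b) => Some (inl b)
  | Some (inr a) => Some (inr (inj a))
  end.

(* Symbols foreign to [T] are read as blanks. *)
Definition sym_prj (s : symbol X) : symbol (tm_aux T) :=
  match s with
  | None => None
  | Some (inl b) => Some (inl b)
  | Some (inr x) => omap inr (prj x)
  end.

Lemma sym_injK : cancel sym_inj sym_prj.
Proof. by case=> [[b|a]|] //=; rewrite injK. Qed.

Lemma sym_inj_tape_of w : sym_inj \o @tape_of (tm_aux T) w = @tape_of X w.
Proof.
apply/funext => i /=; rewrite /tape_of.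
by elim: w i => [|b w IH] [|i] /=.
Qed.

(* State [None] brings the head home. *)
Definition run_on_track (j : 'I_k) : procedure cell :=
  @Procedure cell (option (tm_state T)) (Some (tm_start T))
    (fun q c => match q with
      | None => home_trans None true c
      | Some q => match tm_trans q (sym_prj (c.2 j)) with
          | Some (q', s, d) =>
              inl (Some q', (c.1, [ffun j' => put c.2 j (sym_inj s) j']), d)
          | None => inl (None, c, Stay)
          end
      end).

(** [tm_reaches] adds steps at the end and [runs] at the beginning; hence the continuation form,
    where any run from [c'] extends back to [c]. *)
Lemma run_on_track_reaches (j : 'I_k) S (c c' : config T) b h' t' :
  tm_reaches c c' ->
  @runs _ (run_on_track j) (Some (cfg_state c')) (cfg_head c')
    (tracks (put S j (sym_inj \o cfg_tape c'))) b h' t' ->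
  @runs _ (run_on_track j) (Some (cfg_state c)) (cfg_head c)
    (tracks (put S j (sym_inj \o cfg_tape c))) b h' t'.
Proof.
elim=> // c1 c2 _ IH; rewrite /tm_step.
case e: tm_trans => [[[q s] d]|] // [<-] /= r; apply: IH.
apply: runs_step; first by rewrite /= ffunE put_same /= sym_injK e.
congr runs: r; apply/funext => i; rewrite /tape_write /tracks.
case: (i =P cfg_head c1) => [->|/eqP hi] /=; congr pair; apply/ffunP => j'; rewrite !ffunE.
  by rewrite /put ffunE; case: (j' =P j) => //= _; rewrite eqxx.
by rewrite /put; case: eqP => //= _; rewrite (negbTE hi).
Qed.

Lemma run_on_track_executes (j : 'I_k) W v :
  tm_outputs T (W j) v ->
  executes (run_on_track j) 0 (word_tracks W) true 0 (word_tracks (put W j v)).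
Proof.
move=> [c [r halt /funext out]].
have -> : word_tracks W =
    tracks (put (fun j => @tape_of X (W j)) j (sym_inj \o @tape_of (tm_aux T) (W j))).
  rewrite sym_inj_tape_of; congr tracks; apply/funext => j'.
  by rewrite /put; case: eqP => // ->.
apply: (run_on_track_reaches r).
have -> : word_tracks (put W j v) =
    tracks (put (fun j => @tape_of X (W j)) j (sym_inj \o cfg_tape c)).
  rewrite out sym_inj_tape_of; congr tracks; apply/funext => j'.
  by rewrite /put; case: eqP.
(* [T] may halt with its head anywhere; state [None] then walks back to cell 0. *)
apply: (@runs_stay _ (run_on_track j) _ None Stay); last exact: home_runs.
move: halt; rewrite /tm_step /= ffunE put_same /= sym_injK.
by case: tm_trans => [[[]]|].
Qed.

End RunOnTrack.

(* State [None] scans; state [Some b] brings the head home and exits with [b]. *)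
Definition tracks_differ (j j' : 'I_k) : procedure cell :=
  @Procedure cell (option bool) None
    (fun q c => match q with
      | Some b => home_trans (Some b) b c
      | None =>
          if c.2 j == c.2 j' then
            if c.2 j == None then inl (Some false, c, Stay)
            else inl (None, c, MoveRight)
          else inl (Some true, c, Stay)
      end).

Lemma tracks_differ_executes (j j' : 'I_k) W :
  executes (tracks_differ j j') 0 (word_tracks W) (W j != W j') 0 (word_tracks W).
Proof.
rewrite /executes; set t := word_tracks W.
(* [u] and [v] are the parts of the two words from cell [h] on. Words contain no blank, so two
   blanks in one cell mean that both have ended. *)
suff gen u v h :
    (forall i, @tape_of X (W j) (h + i) = tape_of X u i) ->
    (forall i, @tape_of X (W j') (h + i) = tape_of X v i) ->
    @runs _ (tracks_differ j j') None h t (u != v) 0 t by exact: gen.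
have home b h0 : @runs _ (tracks_differ j j') (Some b) h0 t b 0 t.
  exact: home_runs.
elim: u v h => [|x u IH] [|y v] h eu ev.
- apply: (runs_stay (d := Stay)) (home _ _).
  by rewrite /= !ffunE -(addn0 h) eu ev.
- apply: (runs_stay (d := Stay)) (home _ _).
  by rewrite /= !ffunE -(addn0 h) eu ev.
- apply: (runs_stay (d := Stay)) (home _ _).
  by rewrite /= !ffunE -(addn0 h) eu ev.
rewrite eqseq_cons; have [exy|nexy] := eqVneq x y; last first.
  apply: (runs_stay (d := Stay)) (home _ _).
  rewrite /= !ffunE -(addn0 h) eu ev /=.
  by case: eqP => // -[] exy; rewrite exy eqxx in nexy.
apply: (runs_stay (d := MoveRight)); last first; first apply: (IH v h.+1).
- by move=> i; rewrite addSnnS eu.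
- by move=> i; rewrite addSnnS ev.
by rewrite /= !ffunE -(addn0 h) eu ev /= exy eqxx.
Qed.

End Tracks.

(** * Input and output *)

Section InputOutput.
Variables (k : nat) (X : finType).
Local Notation cell := (cell k.+1 X).

Definition single_cell (s : symbol X) : cell :=
  (false, [ffun j => if j == ord0 then s else None]).

Definition dec (s : symbol cell) : cell :=
  match s with
  | None => single_cell None
  | Some (inl b) => single_cell (Some (inl b))
  | Some (inr c) => c
  end.

(** Cells that stand for a blank or a bit are written as that raw symbol, so that a decoded input or
    output tape is literally a word on the machine's tape. *)
Definition enc (c : cell) : symbol cell :=
  if c == dec None then None
  else if c == dec (Some (inl true)) then Some (inl true)
  else if c == dec (Some (inl false)) then Some (inl false)
  else Some (inr c).

Lemma encK : cancel enc dec.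
Proof.
by move=> c; rewrite /enc; case: eqP => [->|_] //; case: eqP => [->|_] //;
  case: eqP => [->|_].
Qed.

Lemma single_cell_inj : injective single_cell.
Proof. by move=> s s' [] /ffunP /(_ ord0); rewrite !ffunE. Qed.

Lemma enc_single_word w : enc \o (single_cell \o @tape_of X w) = @tape_of cell w.
Proof.
apply/funext => i; rewrite /tape_of /= /enc /=.
elim: w i => [|b w IH] [|i] //=; rewrite ?nth_nil ?eqxx //.
by rewrite !(inj_eq single_cell_inj); case: b.
Qed.

Definition single_word (w : bitstring) : 'I_k.+1 -> bitstring :=
  fun j => if j == ord0 then w else [::].

Definition mark_home : procedure cell :=
  @Procedure cell bool false
    (fun q c => if q then inr true else inl (true, (true, c.2), Stay)).

Lemma mark_home_executes w :
  executes mark_home 0 (single_cell \o @tape_of X w) true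
    0 (word_tracks X (single_word w)).
Proof.
apply: runs_step => //=.
have -> : tape_write (single_cell \o tape_of X w) 0
    (true, (single_cell (tape_of X w 0)).2) = word_tracks X (single_word w).
  apply/funext => i; rewrite /tape_write /word_tracks /tracks.
  case: i => [|i] /=; congr pair; apply/ffunP => j; rewrite !ffunE /single_word;
    by case: eqP => //; rewrite /tape_of ?nth_nil.
exact: runs_exit.
Qed.

Definition extract_track (j : 'I_k.+1) : procedure cell :=
  @Procedure cell unit tt
    (fun q c => if c == single_cell None then inr true
                else inl (tt, single_cell (c.2 j), MoveRight)).

Lemma tape_of_default (w : bitstring) i : (tape_of X w i == None) = (size w <= i).
Proof.
rewrite /tape_of; have [le|lt] := leqP (size w) i.
  by rewrite nth_default ?size_map.
by rewrite (nth_map false).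
Qed.

Lemma extract_track_executes (j : 'I_k.+1) W :
  exists h', executes (extract_track j) 0 (word_tracks X W) true
    h' (single_cell \o @tape_of X (W j)).
Proof.
(* The first cell equal to the blank one: it lies beyond all words, and is at least 1 because the
   flag makes cell 0 nonblank even when all words are empty. *)
pose N := maxn 1 (\max_j size (W j)).
(* The tape once its first [n] cells have been converted. *)
pose t n i := if i < n then single_cell (tape_of X (W j) i) else word_tracks X W i.
have tN : t N = single_cell \o tape_of X (W j).
  apply/funext => i; rewrite /t /=; case: ltnP => //.
  rewrite geq_max => /andP[i0 /bigmax_leqP le].
  rewrite /word_tracks /tracks eqn0Ngt i0; congr pair.
  by apply/ffunP => j'; rewrite !ffunE; case: eqP => [->|_];
    apply/eqP; rewrite ?tape_of_default ?le //;
    have := le j isT; rewrite -tape_of_default => /eqP ->; rewrite tape_of_default le.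
exists N; rewrite -tN.
have -> : word_tracks X W = t 0 by [].
suff gen m n : n + m = N -> @runs _ (extract_track j) tt n (t n) true N (t N).
  exact: (gen N).
elim: m n => [|m IH] n.
  rewrite addn0 => ->; apply: runs_exit => /=.
  rewrite tN /=; have /eqP -> : tape_of X (W j) N == None; last by rewrite eqxx.
  by rewrite tape_of_default leq_max (leq_bigmax j) orbT.
move=> eN; have ltN : n < N by rewrite -eN addnS ltnS leq_addr.
apply: (@runs_step _ (extract_track j) _ _ _ tt (single_cell (tape_of X (W j) n)) MoveRight).
  rewrite /= /t ltnn /= ffunE; case: eqP => // -[] n0 /ffunP blank.
  suff : N <= n by rewrite leqNgt ltN.
  rewrite geq_max lt0n n0; apply/bigmax_leqP => j' _.
  by rewrite -tape_of_default; have := blank j'; rewrite !ffunE => ->; rewrite if_same.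
rewrite /=; have -> : tape_write (t n) n (single_cell (tape_of X (W j) n)) = t n.+1.
  apply/funext => i; rewrite /tape_write /t ltnS (leq_eqVlt i n).
  by case: (i =P n) => [->|].
by apply: IH; rewrite addSnnS.
Qed.

Lemma tm_computes_of_procedure (p : procedure cell) (j : 'I_k.+1)
    (f : bitstring -> bitstring) :
  (forall w, exists2 W, W j = f w &
     executes p 0 (word_tracks X (single_word w)) true 0 (word_tracks X W)) ->
  exists T, tm_computes T f.
Proof.
move=> hp.
exists (tm_of_procedure enc dec (and_then mark_home (and_then p (extract_track j)))).
move=> w; have [W <- rp] := hp w.
have [h' rx] := extract_track_executes j W.
have := and_then_true (mark_home_executes w) (and_then_true rp rx).
move=> /(tm_of_procedure_runs encK)[c [r halt out]].
exists c; split=> //; last by move=> i; rewrite out enc_single_word.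
by rewrite enc_single_word in r.
Qed.

End InputOutput.

(** * Writing a constant, and enumerating the bitstrings *)

Lemma tape_of_cat_size (aux : finType) v b w :
  tape_of aux (v ++ b :: w) (size v) = Some (inl b).
Proof. by rewrite /tape_of map_cat nth_cat size_map ltnn subnn. Qed.

Lemma tape_of_write_cat (aux : finType) v b b' w :
  (fun i => if i == size v then Some (inl b') else tape_of aux (v ++ b :: w) i) =
  tape_of aux (v ++ b' :: w).
Proof.
apply/funext => i; rewrite /tape_of !map_cat !nth_cat size_map.
case: (ltngtP i (size v)) => [//|lt|->]; last by rewrite subnn.
by rewrite -subn_gt0 in lt; case: (i - size v) lt.
Qed.

Lemma tape_of_write_rcons (aux : finType) v b :
  (fun i => if i == size v then Some (inl b) else tape_of aux v i) =
  tape_of aux (rcons v b).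
Proof.
apply/funext => i; rewrite /tape_of map_rcons nth_rcons size_map.
by case: (ltngtP i (size v)) => // lt; rewrite nth_default ?size_map // ltnW.
Qed.

(** The state counts the letters already written. *)
Definition writer (u : bitstring) : turing_machine :=
  @TuringMachine 'I_(size u).+1 void ord0
    (fun i _ => if i < size u
       then Some (inord i.+1, Some (inl (nth false u i)), MoveRight) else None).

Lemma writer_outputs u : tm_outputs (writer u) [::] u.
Proof.
have reach n : n <= size u -> tm_reaches (tm_init (writer u) [::])
    (@Config (writer u) (inord n) n (@tape_of void (take n u))).
  elim: n => [_|n IH lt].
    rewrite take0 /tm_init /=; have -> : inord 0 = ord0 :> 'I_(size u).+1.
      by apply/val_inj; rewrite /= inordK.
    exact: tm_reaches_refl.
  apply: tm_reaches_step (IH (ltnW lt)) _.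
  rewrite /tm_step /= (inordK (leqW lt)) lt; congr (Some (Config _ _ _)).
  by rewrite (take_nth false lt) -tape_of_write_rcons size_takel // ltnW.
exists (@Config (writer u) (inord (size u)) (size u) (@tape_of void (take (size u) u))).
split; [exact: reach|by rewrite /tm_step /= inordK // ltnn|by rewrite take_size].
Qed.

(* Successor in bijective base 2 with digits 1 ([false]) and 2 ([true]), least
   significant digit first. *)
Fixpoint bsucc (w : bitstring) : bitstring :=
  match w with
  | [::] => [:: false]
  | false :: w => true :: w
  | true :: w => false :: bsucc w
  end.

Lemma iter_bsucc_double n w :
  iter n.*2 bsucc (false :: w) = false :: iter n bsucc w.
Proof. by elim: n => //= n ->. Qed.

(** The number of steps is the numerical value of [w]: if the tail has value [n], then the whole has
    value [2n + 1] or [2n + 2], according to its first digit. *)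
Lemma bsucc_reaches w : exists n, iter n bsucc [::] = w.
Proof.
elim: w => [|b w [n <-]]; first by exists 0.
case: b; last by exists n.*2.+1; rewrite iterSr iter_bsucc_double.
by exists n.*2.+2; rewrite iterS iterSr iter_bsucc_double.
Qed.

Definition bsucc_tm : turing_machine :=
  @TuringMachine bool void false
    (fun q s => if q then None else
       match s with
       | Some (inl true) => Some (false, Some (inl false), MoveRight)
       | Some (inl false) => Some (true, Some (inl true), Stay)
       | _ => Some (true, Some (inl false), Stay)
       end).

Lemma bsucc_computable : tm_computes bsucc_tm bsucc.
Proof.
move=> w; rewrite /tm_outputs /tm_init /=.
(* [v] is the prefix that the carry has already passed. *)
suff gen v : exists h, tm_reaches
    (@Config bsucc_tm false (size v) (@tape_of void (v ++ w)))
    (@Config bsucc_tm true h (@tape_of void (v ++ bsucc w))).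
  by have [h r] := gen [::]; eexists; split; [exact: r| |].
elim: w v => [|[] w IH] v /=.
- exists (size v); apply: tm_reaches_step (tm_reaches_refl _) _.
  rewrite cats0 cats1 /tm_step /= {1}/tape_of nth_default ?size_map //.
  by rewrite tape_of_write_rcons.
- have [h r] := IH (rcons v false).
  exists h; rewrite !cat_rcons size_rcons in r.
  apply: tm_reaches_trans r; apply: tm_reaches_step (tm_reaches_refl _) _.
  by rewrite /tm_step /= tape_of_cat_size tape_of_write_cat.
- exists (size v); apply: tm_reaches_step (tm_reaches_refl _) _.
  by rewrite /tm_step /= tape_of_cat_size tape_of_write_cat.
Qed.

(** * Scanning the graph of the encoding *)

Section Conjugation.
Variables (rho hs f g : bitstring -> bitstring) (Ts Tf : turing_machine).
Hypothesis rho_inj : injective rho.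
Hypothesis rho_bsucc : forall w, rho (bsucc w) = hs (rho w).
Hypothesis rho_g : forall w, rho (g w) = f (rho w).
Hypothesis Ts_hs : tm_computes Ts hs.
Hypothesis Tf_f : tm_computes Tf f.

(** A common auxiliary alphabet for all the machines run on tracks; the successor machine and the
    writer have no auxiliary symbols of their own. *)
Let X : finType := (tm_aux Ts + tm_aux Tf)%type.

Let prj_s (x : X) : option (tm_aux Ts) := if x is inl a then Some a else None.
Let prj_f (x : X) : option (tm_aux Tf) := if x is inr a then Some a else None.
Let inj0 (v : void) : X := match v with end.

Let run_s := @run_on_track 5 X Ts inl prj_s.
Let run_f := @run_on_track 5 X Tf inr prj_f.
Let run_succ := @run_on_track 5 X bsucc_tm inj0 (fun=> None).
Let run_write := @run_on_track 5 X (writer (rho [::])) inj0 (fun=> None).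

Let scan (i j p q : 'I_5) : procedure (cell 5 X) :=
  loop (and_then (tracks_differ X i j) (and_then (run_succ p) (run_s q))).

(** Tracks [p] and [q] always hold a pair of the graph of [rho]. The last hypothesis says that the
    comparison of [i] and [j] recognizes the pair of [x]; [n] bounds the number of passes. *)
Let scan_executes (i j p q : 'I_5) (x : bitstring) W n :
  q != p -> iter n bsucc (W p) = x -> W q = rho (W p) ->
  (forall v, let W' := put (put W p v) q (rho v) in (W' i == W' j) = (v == x)) ->
  executes (scan i j p q) 0 (word_tracks X W) true
    0 (word_tracks X (put (put W p x) q (rho x))).
Proof.
move=> qp; elim: n W => [|n IH] W en eW test.
all: have W_id : put (put W p (W p)) q (rho (W p)) = W
  by apply/funext => l; rewrite /put; case: eqP => [->|_] //; case: eqP => [->|].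
all: have := test (W p); rewrite /= W_id => testW.
all: have := tracks_differ_executes X i j W; rewrite testW.
  by rewrite -en /= eqxx W_id => r; apply: loop_exit; apply: and_then_false.
have [<-|ne] := eqVneq (W p) x.
  by rewrite W_id => r; apply: loop_exit; apply: and_then_false.
move=> r.
set W1 := put (put W p (bsucc (W p))) q (rho (bsucc (W p))).
have put2 v : put (put W1 p v) q (rho v) = put (put W p v) q (rho v).
  by apply/funext => l; rewrite /put /W1 /put; case: eqP => // _; case: eqP.
have W1p : W1 p = bsucc (W p) by rewrite /W1 /put eq_sym (negbTE qp) eqxx.
rewrite -put2; apply: (@loop_continue _ _ _ _ 0 (word_tracks X W1)); last first.
  apply: IH; first by rewrite W1p -iterSr.
    by rewrite W1p /W1 put_same.
  by move=> v /=; rewrite put2; exact: test.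
apply: and_then_true r _.
apply: (@and_then_true _ _ _ _ _ 0 (word_tracks X (put W p (bsucc (W p))))).
  by apply: run_on_track_executes => //; exact: bsucc_computable.
apply: run_on_track_executes => //.
by rewrite put_other // eW rho_bsucc; exact: Ts_hs.
Qed.

(* Track 0 holds the input [w]; tracks 1 and 2 list the graph of [rho] until
   track 1 is [w]; tracks 3 and 4 list it until track 4 is [f (rho w)]. *)
Lemma conjugate_computable : exists T, tm_computes T g.
Proof.
pose t1 : 'I_5 := inord 1; pose t2 : 'I_5 := inord 2.
pose t3 : 'I_5 := inord 3; pose t4 : 'I_5 := inord 4.
have neq m n : m < 5 -> n < 5 -> m != n -> (inord m : 'I_5) != inord n.
  by move=> m5 n5; apply: contra_neq => /(congr1 val); rewrite /= !inordK.
have neq0 n : 0 < n < 5 -> (inord n : 'I_5) != ord0.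
  by move=> /andP[n0 n5]; rewrite -val_eqE /= inordK // -lt0n.
have [n10 n20 n30 n40] : [/\ t1 != ord0, t2 != ord0, t3 != ord0 & t4 != ord0].
  by split; exact: neq0.
have [n21 n31 n41] : [/\ t2 != t1, t3 != t1 & t4 != t1] by split; exact: neq.
have [n32 n42 n43] : [/\ t3 != t2, t4 != t2 & t4 != t3] by split; exact: neq.
pose p := and_then (run_write t2) (and_then (run_write t4)
  (and_then (scan ord0 t1 t1 t2) (and_then (run_f t2) (scan t2 t4 t3 t4)))).
apply: (@tm_computes_of_procedure 4 X p t3) => w.
pose W0 := single_word (k := 4) w.
pose W1 := put (put W0 t2 (rho [::])) t4 (rho [::]).
pose W2 := put (put W1 t1 w) t2 (rho w).
pose W3 := put W2 t2 (rho (g w)).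
exists (put (put W3 t3 (g w)) t4 (rho (g w))).
  by rewrite put_other 1?eq_sym // put_same.
have W0n j : j != ord0 -> W0 j = [::] by rewrite /W0 /single_word => /negbTE ->.
(* Tracks 1 and 3 are empty, so writing [rho [::]] on tracks 2 and 4 puts both pairs at the start of
   the graph. *)
apply: (@and_then_true _ _ _ _ _ 0 (word_tracks X (put W0 t2 (rho [::])))).
  by apply: run_on_track_executes => //; rewrite -/W0 W0n //; exact: writer_outputs.
apply: (@and_then_true _ _ _ _ _ 0 (word_tracks X W1)).
  apply: run_on_track_executes => //.
  by rewrite put_other // W0n //; exact: writer_outputs.
apply: (@and_then_true _ _ _ _ _ 0 (word_tracks X W2)).
  have [n en] := bsucc_reaches w.
  have W11 : W1 t1 = [::] by rewrite /W1 !put_other 1?eq_sym // W0n.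
  apply: (@scan_executes _ _ _ _ _ _ n) => //; rewrite ?W11 //.
    by rewrite /W1 put_other 1?eq_sym // put_same.
  move=> v; rewrite /= !(put_other _ _ (j := t2)) 1?eq_sym //.
  rewrite put_same put_other 1?eq_sym // /W1 !put_other 1?eq_sym //.
(* Track 2 holds [rho w], and [f] turns it into [rho (g w)], the target of the second scan. *)
apply: (@and_then_true _ _ _ _ _ 0 (word_tracks X W3)).
  apply: run_on_track_executes => //.
  by rewrite /W2 put_same rho_g; exact: Tf_f.
have [n en] := bsucc_reaches (g w).
have W33 : W3 t3 = [::] by rewrite /W3 /W2 /W1 !put_other // 1?eq_sym // W0n.
apply: (@scan_executes _ _ _ _ _ _ n) => //; rewrite ?W33 //.
  by rewrite /W3 /W2 !put_other // /W1 put_same.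
(* The second scan compares values of [rho]; injectivity makes it stop exactly at [g w]. *)
move=> v; rewrite /= put_same !put_other 1?eq_sym // /W3 put_same.
by rewrite (inj_eq rho_inj) eq_sym.
Qed.

End Conjugation.

Theorem mainTheorem4 (M : model bitstring) (hsup : TM `<=` M)
    (hsim : simulates TM M) : M = TM.
Proof.
apply/seteqP; split=> // g Mg.
have [rho rho_inj sim] := hsim.
have [_ [f [Tf Tf_f] ->] rho_g] := sim g Mg.
(* Since [M] contains TM, the simulation also covers the successor, under the same [rho] as for
   [g]. *)
have Msucc : M (Some \o bsucc).
  by apply: hsup; exists bsucc => //; exists bsucc_tm; exact: bsucc_computable.
have [_ [hs [Ts Ts_hs] ->] rho_s] := sim _ Msucc.
(* The simulating function is total and [omap rho] preserves undefinedness, so [g] is defined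
   everywhere and the default in [g'] below is never taken. *)
have gE w : exists2 v, g w = Some v & rho v = f (rho w).
  move: (congr1 (@^~ w) rho_g) => /=; case: (g w) => //= v [e].
  by exists v.
pose g' w := odflt [::] (g w).
exists g'; last by apply/funext => w; rewrite /g' /=; have [v ->] := gE w.
apply: (@conjugate_computable rho hs f g' Ts Tf) => // w.
  by have [] := congr1 (@^~ w) rho_s.
by rewrite /g'; have [v ->] := gE w.
Qed.
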